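(* Let $m,k\ge1$ with $mk>1$, $q=2^{km}$, $d=2^m$, $n=(q+1)(d-1)$, $N=(q-1)/(d-1)$, $r=q^2$, $\alpha$ a generator of $\mathrm{GF}(r)^*$, $\beta=\alpha^N$, $\mathrm{Tr}$ the trace from $\mathrm{GF}(r)$ to $\mathrm{GF}(q)$, $\mathbf{c}_a=(\mathrm{Tr}(a\beta^0),\dots,\mathrm{Tr}(a\beta^{n-1}))$, and let $\overline{\mathcal{C}}$ be the extended code (appending the coordinate $-\sum_i c_i$ to each codeword $(c_0,\dots,c_{n-1})$) of $\{\mathbf{c}_a+b\mathbf{1}:a\in\mathrm{GF}(r),b\in\mathrm{GF}(q)\}$, $\mathbf{1}$ the all-one vector of length $n$. Then the supports of the codewords of weight $n+1-d$ in $\overline{\mathcal{C}}$ form a $2$-$\left(n+1,\,n+1-d,\,\frac{(n+1-d)(n-d)}{d(d-1)}\right)$ design.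
   Context: The support of a codeword is the set of its nonzero coordinate positions; a $2$-$(v,k,\lambda)$ design is a collection of $k$-subsets (blocks) of a $v$-set such that every pair of points lies in exactly $\lambda$ blocks. *)

(* Defs.v *)
From HB Require Import structures.
From mathcomp Require Import all_boot all_order all_algebra all_fingroup.
From mathcomp Require Import all_solvable all_field.

Set Implicit Arguments.
Unset Strict Implicit.
Unset Printing Implicit Defensive.

Import GRing.Theory.
Local Open Scope ring_scope.

Section Design.
Variable V : finType.

Definition is_2design (v k lambda : nat) (B : {set {set V}}) : Prop :=
  [/\ #|V| = v,
      forall S : {set V}, S \in B -> #|S| = k &
      forall x y : V, x != y ->
        #|[set S in B | (x \in S) && (y \in S)]| = lambda].

End Design.

Section Words.
Variables (F : finFieldType) (n : nat).

Definition supp (c : 'rV[F]_n) : {set 'I_n} := [set i | c 0 i != 0].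

Definition weight (c : 'rV[F]_n) : nat := #|supp c|.

Definition supports_of_weight (C : {set 'rV[F]_n}) (w : nat) :
    {set {set 'I_n}} :=
  [set supp c | c in C & weight c == w].

Definition extend_word (c : 'rV[F]_n) : 'rV[F]_(n + 1) :=
  row_mx c (const_mx (- \sum_(i < n) c 0 i)).

Definition extended_code (C : {set 'rV[F]_n}) : {set 'rV[F]_(n + 1)} :=
  [set extend_word c | c in C].

End Words.

(* L / F plays the role of GF(r) / GF(q). finvect_type L is L itself, carrying
   the finite field structure of a finite extension of a finite field. *)
Section TraceCode.
Variables (F : finFieldType) (L : fieldExtType F).
Local Notation K := (finvect_type L).

(* galTrace takes its values in the copy 1%VS of F inside the extension; the
   trace as an element of F is the unique preimage under c |-> c%:A, which
   always exists by field_traceE. *)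
Definition field_trace (x : K) : F :=
  odflt 0 [pick c : F | c%:A == galTrace 1 {:K} x].

Lemma field_traceE (x : K) : (field_trace x)%:A = galTrace 1 {:K} x.
Proof.
rewrite /field_trace; case: pickP => [c /eqP //|nc].
have gal1 : galois 1 {:K} by rewrite finField_galois ?sub1v.
have /vlineP[c tE] := mem_galTrace gal1 (memvf x).
by move: (nc c); rewrite /= tE eqxx.
Qed.

Definition trace_word (n : nat) (beta a : K) : 'rV[F]_n :=
  \row_(i < n) field_trace (a * beta ^+ i).

Definition augmented_trace_code (n : nat) (beta : K) : {set 'rV[F]_n} :=
  [set trace_word n beta a + const_mx b | a in [set: K], b in [set: F]].

End TraceCode.

(* Main.v *)
(* The powers of beta together with 0 form Denniston's maximal arc
   D = {x : x^(q+1) in GF(d)}, with qd - q + d points. Since the powers of beta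
   sum to 0 and n is odd, the appended coordinate of c_a + b1 is its value at
   x = 0, so the extended code consists of the maps x |-> Tr(ax) + b on D.
   An affine line over GF(q) meets D in at most d points: after scaling, its
   points satisfy an equation of degree d if it passes through 0, and otherwise
   they are the points with y^q = y + 1 among the at most 2d roots of an
   additive polynomial, the remaining ones with y^q = y being at least as many.
   Counting along the q+1 lines through a point of D, every line meeting D does
   so in exactly d points. Hence the secants form a Steiner system S(2, d, n+1),
   and the codewords of weight n+1-d are supported by their complements. *)
Require Import Defs.
From HB Require Import structures.
From mathcomp Require Import all_boot all_order all_algebra all_fingroup.
From mathcomp Require Import all_solvable all_field.
From mathcomp Require Import zify ring.

Set Implicit Arguments.
Unset Strict Implicit.
Unset Printing Implicit Defensive.

Import GRing.Theory.
Local Open Scope ring_scope.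

(** * Double counting in Steiner systems and their complements *)

Lemma sum_card_exchange (I J : finType) (A : {set I}) (B : {set J})
    (R : I -> J -> bool) :
  (\sum_(i in A) #|[set j in B | R i j]| =
   \sum_(j in B) #|[set i in A | R i j]|)%N.
Proof.
under eq_bigr => i _ do rewrite -sum1_card big_set big_mkcondr.
under [RHS]eq_bigr => j _ do rewrite -sum1_card big_set big_mkcondr.
exact: exchange_big.
Qed.

Section Steiner.
Variables (V : finType) (v d : nat) (B : {set {set V}}).
Hypothesis desB : is_2design v d 1 B.

(** Count the pairs of a block through [x] and a further point [y] on it: each block gives [d - 1]
    pairs, and each [y] distinct from [x] gives one. *)
Lemma steiner_replication (x : V) :
  (#|[set S in B | x \in S]| * (d - 1) = v - 1)%N.
Proof.
have [cV cB B2] := desB.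
have := sum_card_exchange [set S in B | x \in S] [set~ x]
  (fun S y => y \in S).
rewrite (eq_bigr (fun=> d - 1)%N); last first.
  move=> S; rewrite inE => /andP[/cB <- xS].
  rewrite [in RHS](cardsD1 x) xS add1n subn1 /=.
  by apply: eq_card => y; rewrite !inE.
rewrite sum_nat_const => ->.
rewrite (eq_bigr (fun=> 1%N)); last first.
  move=> y; rewrite !inE eq_sym => /B2 <-.
  by apply: eq_card => S; rewrite !inE andbA.
by rewrite sum_nat_const muln1 cardsC1 cV subn1.
Qed.

Lemma steiner_size (x : V) : (1 < d)%N ->
  (#|B| * d = v * #|[set S in B | x \in S]|)%N.
Proof.
move=> d_gt1; have [cV cB B2] := desB.
have := sum_card_exchange B [set: V] (fun S y => y \in S).
rewrite (eq_bigr (fun=> d)); last first.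
  by move=> S /cB <-; apply: eq_card => y; rewrite !inE.
rewrite sum_nat_const => ->.
rewrite (eq_bigr (fun=> #|[set S in B | x \in S]|)).
  by rewrite sum_nat_const cardsT cV.
move=> y _; apply/eqP; rewrite -(@eqn_pmul2r (d - 1)) ?subn_gt0 //.
by rewrite !steiner_replication.
Qed.

(** Inclusion-exclusion: with [r] blocks through each point and exactly one through both,
    [#|B| - 2r + 1] blocks avoid [x] and [y]. The factor [d * (d - 1)] clears the denominators of
    [r] and [#|B|]. *)
Lemma steiner_avoid (x y : V) : (1 < d)%N -> x != y ->
  (#|[set S in B | (x \notin S) && (y \notin S)]| * (d * (d - 1)) =
   (v - d) * (v - 1 - d))%N.
Proof.
move=> d_gt1 xy; have [cV cB B2] := desB.
set A := [set S in B | x \in S]; set A' := [set S in B | y \in S].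
have AB : A \subset B by apply/subsetP => S; rewrite inE => /andP[].
have E1 : #|A :&: A'| = 1%N.
  by rewrite -(B2 _ _ xy); apply: eq_card => S; rewrite !inE; case: (S \in B).
set M := [set _ in B | _].
have E2 : (#|M| + #|A :|: A'| = #|B|)%N.
  rewrite -(cardsID (A :|: A') B) addnC; congr (_ + _)%N.
    rewrite (setIidPr _) // subUset AB.
    by apply/subsetP => S; rewrite inE => /andP[].
  apply: eq_card => S; rewrite !inE -andb_orr.
  by case: (S \in B); rewrite //= andbT negb_or.
have := cardsUI A A'; rewrite E1 => E3.
have Ax := steiner_replication x; have Ay := steiner_replication y.
have Bx := steiner_size x d_gt1.
rewrite -/A in Ax Bx; rewrite -/A' in Ay.
have AA : #|A'| = #|A|.
  by apply/eqP; rewrite -(@eqn_pmul2r (d - 1)) ?subn_gt0 // Ax Ay.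
have A0 : (0 < #|A|)%N.
  by apply: leq_trans (subset_leq_card (subsetIl A A')); rewrite E1.
move: Ax Bx E2 E3; rewrite {}AA; clear -d_gt1 A0.
move: #|_ :|: _| #|M| #|A| #|B| A0 => u l r b r0 Ax Bx E2 E3.
(* If [r = 1], the whole set is a single block and both sides vanish. Otherwise [r = s + 2] and
   [d = t + 2] turn the truncated subtractions into exact expressions. *)
have [[|s] rE] : exists s, r = s.+1 by exists (r - 1)%N; lia.
  subst r; have vd : v = d by lia.
  have b1 : b = 1%N.
    by apply/eqP; rewrite -(@eqn_pmul2r d) ?(ltnW d_gt1) // Bx vd mulnC.
  have -> : l = 0%N by lia.
  by rewrite vd subnn.
have [t dE] : exists t, d = t.+2 by exists (d - 2)%N; lia.
subst d r.
have vE : v = (s.+2 * t.+1).+1 by lia.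
have key : (l * t.+2 + s.+1 = s.+1 * s.+1 * t.+1)%N.
  have Ed : ((l + s.+2 + s.+2) * t.+2 = (b + 1) * t.+2)%N.
    by congr (_ * _)%N; lia.
  by rewrite [RHS]mulnDl Bx vE in Ed; lia.
have -> : (v - t.+2 = s.+1 * t.+1)%N by lia.
have -> : (v - 1 - t.+2 = s.+1 * t.+1 - 1)%N by lia.
rewrite mulnA subn1 /= [RHS]mulnAC; congr (_ * _)%N.
by rewrite mulnBr muln1 mulnA; lia.
Qed.

End Steiner.

(** A pair lies in the complement of a block exactly when the block avoids both points, so
    [steiner_avoid] counts the blocks; it also shows that the quotient defining lambda is exact. *)
Lemma complement_steiner (V : finType) (v d : nat) (B : {set {set V}}) :
    (1 < d <= v)%N -> is_2design v d 1 B ->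
  (d * (d - 1) %| (v - d) * (v - 1 - d))%N /\
  is_2design v (v - d) (((v - d) * (v - 1 - d)) %/ (d * (d - 1)))%N
    (@setC V @: B).
Proof.
move=> /andP[d_gt1 dv] desB; have [cV cB B2] := desB.
have dd0 : (0 < d * (d - 1))%N by rewrite muln_gt0 subn_gt0 d_gt1 (ltnW d_gt1).
have V2 : (1 < #|V|)%N by rewrite cV (leq_trans d_gt1).
split.
  have /card_gt1P[x [y [_ _ xy]]] := V2.
  by rewrite -(steiner_avoid desB d_gt1 xy) dvdn_mull.
split=> // [S /imsetP[T /cB cT ->] | x y xy].
  by rewrite cardsCs setCK cV cT.
rewrite -(steiner_avoid desB d_gt1 xy) mulnK //.
rewrite -(card_imset _ (@setC_inj V)); apply: eq_card => S.
rewrite !inE -[S]setCK !(mem_imset _ _ (@setC_inj V)) !inE.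
by rewrite (mem_imset _ _ (@setC_inj V)) setCK !negbK.
Qed.

(** * Denniston's arc and its intersections with lines *)

Lemma card_roots_le (R : finIdomainType) (p : {poly R}) (A : {set R})
    (n : nat) :
  (size p <= n.+1)%N -> p != 0 -> {in A, forall x, root p x} -> (#|A| <= n)%N.
Proof.
move=> sp p0 rA; rewrite cardE -ltnS; apply: leq_trans sp.
apply: max_poly_roots => //; last exact: enum_uniq.
by apply/allP => x; rewrite mem_enum => /rA.
Qed.

Section DennistonArc.
Variables (K : finFieldType) (e m : nat).
Hypothesis K2 : 2%N \in [pchar K].
Hypothesis m_gt0 : (0 < m)%N.
Let q := (2 ^ e)%N.
Let d := (2 ^ m)%N.
Hypothesis oK : #|K| = (q ^ 2)%N.

Let expD n (x y : K) : (x + y) ^+ (2 ^ n) = x ^+ (2 ^ n) + y ^+ (2 ^ n).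
Proof. by rewrite exprDn_pchar // pnatX pnatE // K2. Qed.

Let expq2 (x : K) : x ^+ q ^+ q = x.
Proof. by rewrite -exprM mulnn -oK expf_card. Qed.

(** The trace down to the fixed field of [x |-> x ^+ q], kept as a map of [K] into itself. *)
Definition rel_trace (x : K) := x + x ^+ q.

Let rel_traceD x y : rel_trace (x + y) = rel_trace x + rel_trace y.
Proof. by rewrite /rel_trace expD addrACA. Qed.

Let d_gt1 : (1 < d)%N. Proof. by rewrite (ltn_exp2l 0). Qed.

(** Being fixed by the [d]-th power map expresses that the norm [x ^+ q.+1] lies in GF(d). *)
Definition norm_arc := [set x : K | (x ^+ q.+1) ^+ d == x ^+ q.+1].

Definition arc_line (a b : K) := [set x in norm_arc | rel_trace (a * x) == b].

Let sqr_inj : injective (fun x : K => x ^+ 2).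
Proof.
move=> x y /eqP; rewrite -subr_eq0 GRing.subr_pchar2 // -(expD 1) sqrf_eq0.
by rewrite -(GRing.subr_pchar2 K2) subr_eq0 => /eqP.
Qed.

(** On this line [c = a * x] satisfies [c ^+ q = c], so its norm is [c ^+ 2]. Writing the norm of
    [a] as [g ^+ 2], the norm of [x] is [(c / g) ^+ 2]; since squaring is injective, the arc
    condition becomes [(c / g) ^+ d = c / g], of degree [d] in [c]. *)
Lemma arc_line_through0 (a : K) : a != 0 -> (#|arc_line a 0%R| <= d)%N.
Proof.
move=> a0.
have aI : injective ( *%R a) by apply: mulfI.
rewrite -(card_imset _ aI).
have [g gE] : exists g, a ^+ q.+1 = g ^+ 2.
  (* Inverse of the squaring map: one more squaring gives the power [#|K|]. The case [e = 0] would
     leave [K] with a single element. *)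
  exists ((a ^+ q.+1) ^+ (2 ^ (e + e).-1)).
  have [e0|e0] := posnP e; last first.
    rewrite -exprM -expnSr prednK ?addn_gt0 ?e0 // expnD -/q mulnn -oK.
    by rewrite expf_card.
  by have := finNzRing_gt1 K; rewrite oK /q e0.
have g0 : g != 0 by rewrite -sqrf_eq0 -gE expf_neq0.
pose p : {poly K} := 'X^d - (g ^+ d.-1 *: 'X).
have sp : size p = d.+1.
  rewrite size_polyDl ?size_polyXn // size_polyN.
  by apply: leq_ltn_trans (size_scale_leq _ _) _; rewrite size_polyX.
have pE z : p.[z] = z ^+ d - g ^+ d.-1 * z by rewrite !hornerE.
apply: (@card_roots_le _ p); rewrite ?sp //; first by rewrite -size_poly_gt0 sp.
move=> y /imsetP[x]; rewrite !inE => /andP[/eqP xA /eqP xT] ->.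
move: (a * x) (exprMn q.+1 a x) xT => c cN xT.
have cq : c ^+ q = c.
  by move/eqP: xT; rewrite /rel_trace addr_eq0 oppr_pchar2 // => /eqP.
have xE : x ^+ q.+1 = (c / g) ^+ 2.
  rewrite expr_div_n; have -> : c ^+ 2 = c ^+ q.+1 by rewrite [RHS]exprS cq.
  rewrite cN gE.
  by rewrite mulrAC mulfV ?mul1r // expf_neq0.
have cd : (c / g) ^+ d = c / g.
  by apply: sqr_inj; rewrite exprAC -xE.
rewrite rootE pE -[X in X - _](divfK (expf_neq0 d g0)) -expr_div_n cd.
have -> : g ^+ d = g * g ^+ d.-1 by rewrite -exprS prednK // ltnW.
by rewrite mulrA divfK // mulrC subrr.
Qed.

(** Scaling to [y = (a / b) * x] makes the trace 1, so [y ^+ q = y + 1] and the norm of [y] is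
    [y ^+ 2 + y]. The arc condition then reads [p.[y] = 0] for an additive polynomial [p] of degree
    [2d]. *)
Lemma arc_line_affine (a b : K) : a != 0 -> b != 0 -> b ^+ q = b ->
  (#|arc_line a b| <= d)%N.
Proof.
move=> a0 b0 bq; set A := arc_line a b.
(* The norm of [b / a], because [b ^+ q = b]. *)
pose h := b ^+ 2 / a ^+ q.+1.
have h0 : h != 0 by rewrite mulf_neq0 ?invr_eq0 ?expf_neq0.
pose p : {poly K} := h ^+ d *: ('X^2 + 'X) ^+ d - h *: ('X^2 + 'X).
have sX : size ('X^2 + 'X : {poly K}) = 3.
  by rewrite size_polyDl ?size_polyXn ?size_polyX.
have sXd : size (('X^2 + 'X : {poly K}) ^+ d) = (d + d).+1.
  rewrite -[LHS]prednK ?size_exp ?sX ?mul2n ?addnn //.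
  by rewrite lt0n size_poly_eq0 expf_neq0 // -size_poly_eq0 sX.
have sp : size p = (d + d).+1.
  rewrite size_polyDl size_scale ?expf_neq0 // size_polyN size_scale // sXd sX.
  by rewrite ltnS -addn1 leq_add ?(ltnW d_gt1).
have pE y : p.[y] = (h * (y ^+ 2 + y)) ^+ d - h * (y ^+ 2 + y).
  by rewrite !(horner_exp, hornerE) -exprMn.
pose W := [set y | root p y].
have WD y z : y \in W -> z \in W -> y + z \in W.
  rewrite !inE !rootE !pE !subr_eq0 => /eqP Ey /eqP Ez.
  rewrite (expD 1) addrACA mulrDr expD Ey Ez; exact/eqP.
have oW : (#|W| <= d + d)%N.
  apply: (@card_roots_le _ p); rewrite ?sp //.
    by rewrite -size_poly_gt0 sp.
  by move=> y; rewrite inE.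
pose Y := [set y in W | rel_trace y == 1].
pose Z := [set y in W | rel_trace y == 0].
have AY : (#|A| <= #|Y|)%N.
  have I : injective ( *%R (a / b)).
    by apply: mulfI; rewrite mulf_neq0 ?invr_eq0.
  rewrite -(card_imset _ I); apply/subset_leq_card/subsetP => y /imsetP[x].
  rewrite !inE => /andP[xA /eqP xT] ->.
  set y' := _ * x.
  have yT : rel_trace y' = 1.
    have ->: y' = (a * x) / b by rewrite /y' mulrAC.
    rewrite /rel_trace exprMn exprVn bq -mulrDl -/(rel_trace _) xT divff //.
  rewrite yT eqxx andbT rootE pE.
  suff -> : h * (y' ^+ 2 + y') = x ^+ q.+1 by rewrite subr_eq0.
  have <- : y' ^+ q.+1 = y' ^+ 2 + y'.
    have -> : y' ^+ 2 + y' = y' * (y' + rel_trace y').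
      by rewrite yT mulrDr mulr1.
    by rewrite /rel_trace addrA addrr_pchar2 // add0r exprS.
  rewrite /h /y' !exprMn exprVn [b ^+ q.+1]exprS bq -expr2.
  by field; rewrite b0 expf_neq0.
have [Y0|[y0 y0Y]] := set_0Vmem Y.
  by apply: leq_trans AY _; rewrite Y0 cards0.
(* Adding a fixed [y0] in [Y] sends roots of trace 1 to roots of trace 0. As [Y] and [Z] are
   disjoint in [W], twice [#|Y|] is at most [2d]. *)
have YZ : (#|Y| <= #|Z|)%N.
  rewrite -(card_imset _ (addrI y0)); apply/subset_leq_card/subsetP => y.
  move=> /imsetP[z zY ->]; move: zY y0Y; rewrite !inE.
  move=> /andP[zW /eqP zT] /andP[y0W /eqP y0T].
  have := WD _ _ (_ : y0 \in W) (_ : z \in W); rewrite !inE => -> //=.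
  by rewrite rel_traceD zT y0T addrr_pchar2.
suff : (#|Y| + #|Z| <= #|W|)%N by lia.
have /leqifP := leq_card_setU Y Z.
have -> : [disjoint Y & Z].
  rewrite -setI_eq0; apply/eqP/setP => y; rewrite !inE.
  by case: eqP => [->|]; rewrite ?oner_eq0 ?andbF.
move=> /eqP <-; apply/subset_leq_card/subsetP => y.
by rewrite !inE => /orP[] /andP[].
Qed.

Lemma arc_line_le (a b : K) : a != 0 -> b ^+ q = b ->
  (#|arc_line a b| <= d)%N.
Proof.
move=> a0 bq; have [->|b0] := eqVneq b 0; first exact: arc_line_through0.
exact: arc_line_affine.
Qed.

(** Lines through [x] are counted by their nonzero coefficients [c]. Each of the [(q + 1)(d - 1)]
    other points of [D] lies on the line of at least [q - 1] coefficients, so the total reaches the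
    upper bound [d - 1] for each of the [q ^ 2 - 1] coefficients, and every bound is attained. *)
Lemma arc_line_card (D : {set K}) (x a : K) :
    #|D| = (q.+1 * (d - 1) + 1)%N -> D \subset norm_arc ->
    (q <= #|[set t : K | t ^+ q == t]|)%N ->
    x \in D -> a != 0 ->
  #|[set y in D | rel_trace (a * y) == rel_trace (a * x)]| = d.
Proof.
move=> oD DN fixq xD a0.
have rel_trace_fixed z : rel_trace z ^+ q = rel_trace z.
  by rewrite /rel_trace expD expq2 addrC.
pose l a := #|[set y in D :\ x | rel_trace (a * y) == rel_trace (a * x)]|.
have lE c : #|[set y in D | rel_trace (c * y) == rel_trace (c * x)]| = (l c).+1.
  rewrite (cardsD1 x) !inE xD eqxx add1n; congr _.+1.
  by apply: eq_card => y; rewrite !inE andbA.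
have l_le c : c \in [set~ 0%R] -> (l c <= d - 1)%N.
  rewrite !inE => c0; rewrite leq_subRL ?(ltnW d_gt1) // add1n -lE.
  apply: leq_trans (arc_line_le c0 (rel_trace_fixed (c * x))).
  apply/subset_leq_card/subsetP => y; rewrite !inE => /andP[/(subsetP DN)].
  by rewrite inE => ->.
have le_sum : (#|[set~ 0%R : K]| * (d - 1) <= \sum_(c in [set~ 0%R]) l c)%N.
  rewrite sum_card_exchange.
  apply: (@leq_trans (\sum_(y in D :\ x) (q - 1))).
    rewrite sum_nat_const cardsC1 oK -mulnn.
    have -> : #|D :\ x| = (q.+1 * (d - 1))%N.
      by move: oD; rewrite (cardsD1 x) xD; lia.
    have : (0 < q)%N by rewrite expn_gt0.
    case: (q) => // q' _; rewrite subn1 mulSn addSn /=; lia.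
  apply: leq_sum => y; rewrite !inE => /andP[yx yD].
  have I : injective ( *%R^~ (y - x)^-1).
    by apply: mulIf; rewrite invr_eq0 subr_eq0.
  (* For [t] in [U], the coefficient [t / (y - x)] puts [x] and [y] on one line, as [t] has trace
     [t + t = 0]. *)
  pose U := [set t : K | t ^+ q == t] :\ 0.
  have oU : (q - 1 <= #|U|)%N.
    move: fixq; rewrite (cardsD1 0) inE expr0n -/U.
    have -> : (q == 0%N) = false by rewrite expn_eq0.
    by rewrite eqxx leq_subLR.
  apply: leq_trans oU _; rewrite -(card_imset _ I).
  apply/subset_leq_card/subsetP => c /imsetP[t].
  rewrite !inE => /andP[t0 /eqP tq] ->.
  have yx0 : y - x != 0 by rewrite subr_eq0.
  rewrite mulf_neq0 ?invr_eq0 //=.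
  have -> : t / (y - x) * y = t + t / (y - x) * x.
    by rewrite -{2}(divfK yx0 t) -mulrDr subrK.
  by rewrite rel_traceD {1}/rel_trace tq addrr_pchar2 // add0r.
(* Equality of the sums forces equality in each term. *)
have [_ /esym] := leqif_sum (fun c cP => leqif_geq (l_le c cP)).
rewrite sum_nat_const eqn_leq le_sum andbT.
have -> : (\sum_(c in [set~ 0%R]) l c <= #|[set~ 0%R : K]| * (d - 1))%N.
  by rewrite -sum_nat_const leq_sum.
move/forall_inP/(_ a); rewrite !inE => /(_ a0) la.
have := l_le a; rewrite !inE => /(_ a0) la'.
rewrite lE; apply/eqP; rewrite eqn_leq; lia.
Qed.

(** * The Steiner system of secants *)

(** Each line is taken through some [pt j], which leaves out those missing the arc. Blocks consist
    of indices, to be compared with supports of codewords. *)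
Definition secants (V : finType) (pt : V -> K) : {set {set V}} :=
  [set [set i | rel_trace (a * pt i) == rel_trace (a * pt j)]
    | a in [set~ 0], j in [set: V]].

Lemma secants_steiner (V : finType) (pt : V -> K) :
    injective pt -> #|V| = (q.+1 * (d - 1) + 1)%N ->
    (forall i, pt i \in norm_arc) ->
    (q <= #|[set t : K | t ^+ q == t]|)%N ->
  is_2design #|V| d 1 (secants pt).
Proof.
move=> pt_inj oV ptN fixq; pose D := pt @: [set: V].
have oD : #|D| = (q.+1 * (d - 1) + 1)%N by rewrite card_imset // cardsT.
have ptD i : pt i \in D by rewrite imset_f ?inE.
have DN : D \subset norm_arc by apply/subsetP => _ /imsetP[i _ ->].
split=> // [S /imset2P[a j] | x y xy].
  rewrite !inE => a0 _ ->.
  rewrite -(arc_line_card oD DN fixq (ptD j) a0) -(card_imset _ pt_inj).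
  apply: eq_card => z; apply/imsetP/idP => [[i]|].
    by rewrite !inE => ij ->; rewrite ptD.
  by rewrite !inE => /andP[/imsetP[i _ ->] ij]; exists i; rewrite ?inE.
have xy0 : pt x - pt y != 0 by rewrite subr_eq0 (inj_eq pt_inj).
(* Then [a0 * (pt x - pt y) = 1] has trace 0, so this coefficient gives a secant through both
   points. *)
pose a0 := (pt x - pt y)^-1.
have a00 : a0 != 0 by rewrite invr_eq0.
have rel_traceB u v : (rel_trace u == rel_trace v) = (rel_trace (u - v) == 0).
  by rewrite -subr_eq0 !(GRing.subr_pchar2 K2) rel_traceD.
have rel_trace_eq0 t : (rel_trace t == 0) = (t ^+ q == t).
  by rewrite /rel_trace addrC addr_eq0 oppr_pchar2.
pose S0 := [set i | rel_trace (a0 * pt i) == rel_trace (a0 * pt x)].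
rewrite -(cards1 S0); apply: eq_card => S; rewrite !inE.
apply/and3P/eqP => [[/imset2P[a j]] | ->]; last first.
  split; first by apply/imset2P; exists a0 x; rewrite ?inE.
    by rewrite inE.
  by rewrite inE eq_sym rel_traceB -mulrBr mulVf // rel_trace_eq0 expr1n.
rewrite !inE => a_neq0 _ -> {S}; rewrite !inE => /eqP xj /eqP yj.
(* Any other coefficient for the pair differs from [a0] by a factor in GF(q), which does not change
   the line. *)
have tq : (a / a0) ^+ q = a / a0.
  by apply/eqP; rewrite -rel_trace_eq0 invrK mulrBr -rel_traceB xj yj.
apply/setP => i; rewrite !inE -xj !rel_traceB -!mulrBr !rel_trace_eq0.
have -> z : a * z = a / a0 * (a0 * z) by rewrite mulrA divfK.
rewrite exprMn tq.
by rewrite (inj_eq (mulfI _)) // mulf_neq0 ?invr_eq0.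
Qed.

End DennistonArc.

(** * The trace of a quadratic extension and the extended codewords *)

Section QuadraticExtension.
Variables (F : finFieldType) (L : fieldExtType F).
Local Notation K := (finvect_type L).

(** The Galois group is generated by the Frobenius [s], of order 2, so the trace sums over the
    identity and [s] only. *)
Lemma field_trace_quadratic (x : K) :
  #|K| = (#|F| ^ 2)%N -> (field_trace x)%:A = x + x ^+ #|F|.
Proof.
move=> oK; rewrite field_traceE /galTrace.
have dimK : \dim {:K} = 2%N.
  apply: (@expnI #|F|); first exact: finNzRing_gt1.
  rewrite -oK -(card_vspace (T := K) {:K}%VS).
  by apply: eq_card => y; rewrite memvf.
have [s gen_s sE] := finField_galois_generator (sub1v {:K}%AS).
have gal1 : galois 1 {:K} by rewrite finField_galois ?sub1v.
have os : #[s]%g = 2%N.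
  have := galois_dim gal1; rewrite dimv1 divn1 dimK => ->.
  by rewrite orderE -(eqP gen_s).
have s1 : s != 1%g by rewrite -order_eq1 os.
rewrite (eqP gen_s) cycle2g // big_setU1 ?inE 1?eq_sym // big_set1 gal_id.
by rewrite sE ?memvf // dimv1 expn1.
Qed.

Lemma field_trace_sum (I : finType) (f : I -> K) :
  \sum_i field_trace (f i) = field_trace (\sum_i f i).
Proof.
apply: (fmorph_inj (in_alg K)); rewrite rmorph_sum /= field_traceE raddf_sum.
by apply: eq_bigr => i _; rewrite field_traceE.
Qed.

(** The point of the arc attached to each coordinate; the appended one receives 0. *)
Definition eval_point (n : nat) (beta : K) (i : 'I_(n + 1)) : K :=
  if (i < n)%N then beta ^+ i else 0.

Lemma extend_trace_wordE (n : nat) (beta a : K) (b : F) (i : 'I_(n + 1)) :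
    2%N \in [pchar F] -> odd n -> beta ^+ n = 1 -> beta != 1 ->
  extend_word (trace_word n beta a + const_mx b) 0 i =
  field_trace (a * eval_point beta i) + b.
Proof.
move=> F2 n_odd beta_n beta1; rewrite /extend_word /eval_point.
case: (splitP i) => j ij.
  have -> : i = lshift 1 j by apply: val_inj.
  by rewrite row_mxEl !mxE.
have -> : i = rshift n j by apply: val_inj.
rewrite row_mxEr mxE oppr_pchar2 //.
under eq_bigr => l _ do rewrite !mxE.
rewrite big_split /= sumr_const card_ord field_trace_sum -mulr_sumr.
(* Multiplied by [beta - 1], the geometric sum telescopes to [beta ^+ n - 1 = 0]; what remains of
   the appended coordinate is [n] copies of [b], which is [b] for odd [n] in characteristic 2. *)
have -> : \sum_(l < n) beta ^+ l = 0.
  apply: (mulfI (_ : beta - 1 != 0)); first by rewrite subr_eq0.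
  by rewrite -subrX1 beta_n subrr mulr0.
by rewrite -mulr_natr -(GRing.natr_mod_pchar F2) modn2 n_odd mulr1.
Qed.

End QuadraticExtension.

Lemma expr_prim_inj (R : finFieldType) (u : {unit R}) (N n i j : nat) :
    (N * n)%N = #[u]%g -> (i < n)%N -> (j < n)%N ->
  (val u ^+ N) ^+ i = (val u ^+ N) ^+ j -> i = j.
Proof.
move=> ou lt_i lt_j; rewrite -!exprM -!FinRing.val_unitX => /val_inj/eqP.
have N_gt0 : (0 < N)%N by case: N ou (order_gt0 u) => // <-.
rewrite eq_expg_mod_order -ou -!muln_modr !modn_small // eqn_pmul2l //.
by move=> /eqP.
Qed.

(* Identification of the supports with complements of secants *)
Local Close Scope ring_scope.

Theorem theorem7 (m k : nat) (m_ge1 : (1 <= m)%N) (k_ge1 : (1 <= k)%N)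
    (mk_gt1 : (1 < m * k)%N)
    (F : finFieldType) (L : fieldExtType F)
    (alpha : {unit (finvect_type L)}) :
  let q := (2 ^ (k * m))%N in
  let d := (2 ^ m)%N in
  let n := ((q + 1) * (d - 1))%N in
  let N := ((q - 1) %/ (d - 1))%N in
  let r := (q ^ 2)%N in
  #|F| = q ->
  #|finvect_type L| = r ->
  generator [set: {unit (finvect_type L)}] alpha ->
  let beta : finvect_type L := (val alpha ^+ N)%R in
  let C := extended_code (augmented_trace_code n beta) in
  (d * (d - 1) %| (n + 1 - d) * (n - d))%N /\
  is_2design (n + 1) (n + 1 - d)
    (((n + 1 - d) * (n - d)) %/ (d * (d - 1)))%N
    (supports_of_weight C (n + 1 - d)).
Proof.
move=> q d n N r oF oK gen_alpha beta C.
have q_gt1 : (1 < q)%N by rewrite (ltn_exp2l 0) // muln_gt0 k_ge1.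
have d_gt1 : (1 < d)%N by rewrite (ltn_exp2l 0).
have n_gt1 : (1 < n)%N.
  by apply: (@leq_trans (3 * 1)); rewrite ?leq_mul // ?addn1 ?subn_gt0.
have F2 : 2%N \in ([pchar F])%R by apply: card_finPcharP oF _.
have K2 : 2%N \in ([pchar (finvect_type L)])%R.
  apply: (@card_finPcharP (finvect_type L) 2 (k * m * 2)) => //.
  by rewrite oK /r /q -expnM.
(* Since [d - 1] divides [q - 1], the product is [(q - 1)(q + 1) = r - 1]. *)
have Nn : (N * n)%N = #[alpha]%g.
  rewrite orderE -(eqP gen_alpha) card_finField_unit oK /n mulnCA divnK.
    by rewrite mulnC -subn1 -[in RHS](exp1n 2) subn_sqr.
  by rewrite !subn1 /q mulnC expnM dvdn_pred_predX.
have beta_n : (beta ^+ n = 1)%R.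
  by rewrite /beta -exprM Nn -FinRing.val_unitX expg_order.
have beta_inj i j : (i < n)%N -> (j < n)%N ->
    (beta ^+ i = beta ^+ j)%R -> i = j by apply: expr_prim_inj Nn.
have beta1 : (beta != 1)%R.
  apply/eqP => b1; have := @beta_inj 0 1 (ltnW n_gt1) n_gt1.
  by rewrite b1 !expr1n => /(_ erefl).
have beta0 i : (beta ^+ i != 0)%R.
  rewrite expf_neq0 //; apply: contraNneq (oner_neq0 (finvect_type L)) => b0.
  by rewrite -beta_n b0 expr0n; case: (n) n_gt1.
have n_odd : odd n.
  rewrite /n oddM oddD oddB ?(ltnW d_gt1) // /q /d !oddX.
  by rewrite muln_eq0 !eqn0Ngt m_ge1 k_ge1.
pose pt := @eval_point F L n beta.
have pt_inj : injective pt.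
  move=> i j; rewrite /pt /eval_point.
  have le_n (l : 'I_(n + 1)) : (n <= l)%N -> l = n :> nat.
    by have := ltn_ord l; lia.
  case: ltnP => [lt_i | /le_n i_n]; case: ltnP => [lt_j | /le_n j_n].
  - by move/beta_inj => E; apply/val_inj/E.
  - by move/eqP; rewrite (negPf (beta0 _)).
  - by move/esym/eqP; rewrite (negPf (beta0 _)).
  - by move=> _; apply/val_inj; rewrite /= i_n j_n.
have oV : #|'I_(n + 1)| = (q.+1 * (d - 1) + 1)%N by rewrite card_ord -(addn1 q).
have ptN i : pt i \in norm_arc (finvect_type L) (k * m) m.
  rewrite inE /pt /eval_point; case: ifP => _; last by rewrite !expr0n expn_eq0.
  have s1 : (((beta ^+ i) ^+ q.+1) ^+ (d - 1) = 1)%R.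
    by rewrite -(exprM (beta ^+ i)) -(addn1 q) -/n exprAC beta_n expr1n.
  by rewrite -/q -/d -{1}(subnK (ltnW d_gt1)) exprD s1 mul1r expr1.
(* The embedded copy of [F] supplies [q] fixed points. *)
have fixq : (q <= #|[set t : (finvect_type L) | t ^+ q == t]%R|)%N.
  have imF : #|[set in_alg (finvect_type L) c | c in [set: F]]%R| = q.
    by rewrite card_imset ?cardsT //; apply: fmorph_inj.
  rewrite -{1}imF; apply/subset_leq_card/subsetP => _ /imsetP[c _ ->].
  by rewrite inE -rmorphXn /= -oF expf_card.
have dn : (d < n + 1)%N.
  have : (d - 1 < n)%N by rewrite ltn_Pmull ?subn_gt0 // addn1 ltnS ltnW.
  lia.
have stV := secants_steiner K2 m_ge1 oK pt_inj oV ptN fixq.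
rewrite card_ord in stV.
have trE x : (field_trace x)%:A%R = rel_trace (k * m) x :> (finvect_type L).
  by rewrite field_trace_quadratic ?oF.
suff -> : supports_of_weight C (n + 1 - d) = @setC _ @: secants (k * m) pt.
  have := complement_steiner _ stV; rewrite addnK; apply.
  by rewrite d_gt1 ltnW.
have suppE a b : supp (extend_word (trace_word n beta a + const_mx b)%R) =
    ~: [set i | rel_trace (k * m) (a * pt i)%R == b%:A%R].
  apply/setP => i; rewrite !inE extend_trace_wordE // -/(pt i).
  rewrite addr_eq0 oppr_pchar2 // -trE.
  by rewrite (inj_eq (fmorph_inj (in_alg (finvect_type L)))).
have [_ secant_card _] := stV.
apply/setP => S; apply/imsetP/imsetP.
  move=> [c]; rewrite inE => /andP[/imsetP[_ /imset2P[a b _ _ ->] ->] /eqP].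
  rewrite /weight suppE => oZ ->; set Z := finset _ in oZ *; exists Z => //.
  (* The zero set has [d > 0] elements, hence a point through which to describe it as a line. *)
  have oZd : #|Z| = d by have := cardsC Z; rewrite card_ord oZ; lia.
  have /card_gt0P[j jZ] : (0 < #|Z|)%N by rewrite oZd ltnW.
  have jE : rel_trace (k * m) (a * pt j)%R = b%:A%R.
    by move: jZ; rewrite inE => /eqP.
  apply/imset2P; exists a j; rewrite ?inE ?jE //.
  (* For [a = 0] the word is constant with a zero, so all [n + 1 > d] coordinates would vanish. *)
  apply/eqP => a0; have : #|Z| = (n + 1)%N.
    rewrite -[RHS]card_ord -cardsT; apply: eq_card => i.
    by rewrite !inE -jE a0 !mul0r eqxx.
  lia.
move=> [Z ZS ->]; have oZ := secant_card _ ZS.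
have /imset2P[a j _ _ ZE] := ZS.
(* In characteristic 2 this constant makes the word vanish exactly on the given secant. *)
pose b := field_trace (a * pt j)%R.
exists (extend_word (trace_word n beta a + const_mx b)%R).
  rewrite inE /weight suppE trE -ZE cardsCs setCK card_ord oZ eqxx andbT.
  by apply/imset_f/imset2P; exists a b; rewrite ?inE.
by rewrite suppE trE -ZE.
Qed.
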